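(* Let $N\ge1$. Suppose that (i) there is $c>0$ with $c\|x\|^2\le\ell(x,u,i)$ for all $(x,u)\in Y_i$, $i\in\mathcal N$; (ii) there is $d>0$ with $\ell_N(x,i)\le d\|x\|^2$ for all $x\in X^f_i$, $i\in\mathcal N$; (iii) each $X^f_i$, $i\in\mathcal N$, contains the origin in its interior; (iv) $V_N^\star$ is locally bounded over its domain: for every compact $\bar X\subseteq\operatorname{dom}V_N^\star$ there is $M\ge0$ such that $V_N^\star(x,i)\le M$ for all $(x,i)\in\bar X$; (v) $\mathbf T\ell_N\le\ell_N$ (pointwise on $\mathbb R^{n_x}\times\mathcal N$). Let $\kappa_N^\star$ be a control law with $\kappa_N^\star(x,i)\in\mathcal U_N^\star(x,i)$ for all $(x,i)\in\operatorname{dom}V_N^\star$. Then the origin is risk-square exponentially stable (RSES) for the MPC-controlled system $x_{k+1}=f(x_k,\kappa_N^\star(x_k,i_k),i_k)$ over every compact uniformly invariant subset of $\operatorname{dom}V_N^\star$.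
   Context: Let $\mathcal N=\{1,\dots,n\}$ and let $(i_k)_{k\in\mathbb N}$ be a time-homogeneous Markov chain on $\mathcal N$ with transition matrix $P=(p_{ij})$; $P_i$ denotes the $i$-th row of $P$, and $\operatorname{cov}(i)=\{j\in\mathcal N: p_{ij}>0\}$. For a nonempty set $E$, $\operatorname{fcns}(E,\mathcal N)$ is the set of functions $V:E\times\mathcal N\to\mathbb R\cup\{+\infty\}$ with $V(x,i)\ge0$ and $V(0,i)=0$ for all $x\in E$, $i\in\mathcal N$. Domains are sets of points where the function is finite. A collection $(C_i)_{i\in\mathcal N}$ of sets is identified with $\{(x,i):x\in C_i\}$ (it is compact if every $C_i$ is). System and costs. For each $i\in\mathcal N$, $f(\cdot,\cdot,i):\mathbb R^{n_x}\times\mathbb R^{n_u}\to\mathbb R^{n_x}$ is continuous with $f(0,0,i)=0$, and $Y_i\subseteq\mathbb R^{n_x}\times\mathbb R^{n_u}$ is a nonempty closed set containing the origin. The stage cost is $\ell\in\operatorname{fcns}(\mathbb R^{n_x}\times\mathbb R^{n_u},\mathcal N)$ with $\operatorname{dom}\ell(\cdot,\cdot,i)=Y_i$, and the terminal cost is $\ell_N\in\operatorname{fcns}(\mathbb R^{n_x},\mathcal N)$ with $\operatorname{dom}\ell_N(\cdot,i)=X^f_i$. Risk. A coherent risk measure $\rho$ is given with ambiguity sets $\mathcal A(p)$: for every probability vector $p\in\mathbb R^n$, $\mathcal A(p)\subseteq\mathbb R^n$ is a compact convex set of probability vectors containing $p$. The associated Markov risk measure is $$\rho_i[Z;j]=\max_{\mu\in\mathcal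 A(P_i)}\sum_{j\in\mathcal N}\mu_jZ(i,j),$$ where the risk is taken with respect to $j$ (for $[0,+\infty]$-valued $Z$: supremum, with $0\cdot\infty=0$). For a random variable $\psi(i_0,\dots,i_k)$, the nested risk measure is $$\bar\rho_k[\psi]=\rho_{i_0}\Big[\rho_{i_1}\big[\cdots\rho_{i_{k-1}}[\psi(i_0,\dots,i_k);i_k]\cdots;i_2\big];i_1\Big],$$ and $\bar\rho_k$ is the identity for $k\le0$. Dynamic programming. For $V\in\operatorname{fcns}(\mathbb R^{n_x},\mathcal N)$ let $$(\mathbf TV)(x,i)=\inf_{u\in\mathbb R^{n_u}}\Big\{\ell(x,u,i)+\rho_i\big[V(f(x,u,i),j);j\big]\Big\},$$ and let $(\mathbf SV)(x,i)$ be the set of minimizers of this problem. Define $V_0^\star=\ell_N$, $V_{k+1}^\star=\mathbf TV_k^\star$ and $\mathcal U_{k+1}^\star=\mathbf SV_k^\star$ for $k=0,\dots,N-1$. Closed loop. For a control law $\kappa$, set $f^\kappa(x,i)=f(x,\kappa(x,i),i)$ and $X^\kappa_i=\{x:(x,\kappa(x,i))\in Y_i\}$. Outside $\operatorname{dom}V_N^\star$, $\kappa_N^\star$ may be taken arbitrary. With $i_{[k]}=(i_0,\dots,i_k)$ an admissible path of the chain ($i_{t+1}\in\operatorname{cov}(i_t)$), $\phi(k,x_0,i_{[k-1]})$ is the solution at time $k$ of $x_{k+1}=f^\kappa(x_k,i_k)$ starting from $x_0$. Uniform invariance. A collection $X=(X_i)_{i\in\mathcal N}$ of nonempty closed subsets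 of $\mathbb R^{n_x}$ with $X_i\subseteq X_i^\kappa$ is uniformly invariant for $x_{k+1}=f^\kappa(x_k,i_k)$ if for all $i\in\mathcal N$ and $x\in X_i$ one has $f^\kappa(x,i)\in\bigcap_{j\in\operatorname{cov}(i)}X_j$. RSES. The origin is risk-square exponentially stable for $x_{k+1}=f^\kappa(x_k,i_k)$ over $X=(X_i)_{i\in\mathcal N}$ if $X$ is uniformly invariant and there exist $\beta\in[0,1)$ and $\lambda\ge0$ such that for all $i_0\in\mathcal N$, $x_0\in X_{i_0}$ and $k\in\mathbb N$, $$\bar\rho_{k-1}\big[\|\phi(k,x_0,i_{[k-1]})\|^2\big]\le\lambda\beta^k\|x_0\|^2.$$
   Formalization: The squared norm of the solution is taken as 0 along mode paths that are not admissible, where the solution is undefined but the ambiguity sets may put mass; counting such paths via the recursion would make the claim false. Nothing changes if A(P_i) is supported on cov(i). *)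

(* Defs.v *)
From HB Require Import structures.
From mathcomp Require Import all_boot all_order all_algebra.
From mathcomp Require Import all_classical all_reals all_analysis.
Set Implicit Arguments.
Unset Strict Implicit.
Unset Printing Implicit Defensive.
Import Order.TTheory GRing.Theory Num.Theory.
Import numFieldNormedType.Exports.
Local Open Scope classical_set_scope.
Local Open Scope ring_scope.
Local Open Scope ereal_scope.

(* The library norm on ['rV_d] is the max norm. Both norms induce the topology
   that the library puts on ['rV_d]. *)
Definition enorm (R : realType) (d : nat) (x : 'rV[R]_d) : R :=
  Num.sqrt (\sum_(j < d) x ord0 j ^+ 2)%R.

Section Risk.
Variables (R : realType) (n : nat).

Definition prob_vec (p : 'rV[R]_n) : Prop :=
  (forall j, 0 <= p ord0 j)%R /\ (\sum_j p ord0 j = 1)%R.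

Definition transition_matrix (P : 'M[R]_n) : Prop :=
  forall i, prob_vec (row i P).

Definition cov (P : 'M[R]_n) (i : 'I_n) : {set 'I_n} :=
  [set j : 'I_n | (0 < P i j)%R]%SET.

Definition ambiguity (A : 'rV[R]_n -> set 'rV[R]_n) : Prop :=
  forall p, prob_vec p ->
    [/\ compact (A p),
        convex_set (A p : set (convex_lmodType 'rV[R]_n)),
        A p `<=` [set mu | prob_vec mu]
      & A p p].

(* In [\bar R], [0 * +oo = 0]. *)
Definition risk (A : 'rV[R]_n -> set 'rV[R]_n) (P : 'M[R]_n) (i : 'I_n)
    (Z : 'I_n -> \bar R) : \bar R :=
  ereal_sup [set \sum_(j < n) (mu ord0 j)%:E * Z j | mu in A (row i P)].

Definition admissible (P : 'M[R]_n) (s : seq 'I_n) : bool :=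
  sorted (fun i j => j \in cov P i) s.

(* A random variable on the chain is given on admissible paths only; all other
   paths have probability zero, and it is extended to them by 0. The extension
   matters only when some [mu] in [A (row i P)] charges a mode outside
   [cov P i]. *)
Definition on_paths (P : 'M[R]_n) (psi : seq 'I_n -> \bar R) :
    seq 'I_n -> \bar R :=
  fun s => if admissible P s then psi s else 0.

Fixpoint nest (rho : 'I_n -> ('I_n -> \bar R) -> \bar R) (k : nat)
    (psi : seq 'I_n -> \bar R) (i : 'I_n) : \bar R :=
  if k is k'.+1 then rho i (fun j => nest rho k' (fun s => psi (i :: s)) j)
  else psi [:: i].

(* [nested_risk A P k psi i0] evaluates [psi] on paths [:: i_0; ...; i_k]. *)
Definition nested_risk (A : 'rV[R]_n -> set 'rV[R]_n) (P : 'M[R]_n) (k : nat)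
    (psi : seq 'I_n -> \bar R) (i0 : 'I_n) : \bar R :=
  nest (risk A P) k (on_paths P psi) i0.

End Risk.

Section Fcns.
Variables (R : realType) (n : nat) (E : zmodType).

Definition fcns (V : E -> 'I_n -> \bar R) : Prop :=
  (forall x i, 0 <= V x i) /\ (forall i, V 0%R i = 0).

Definition dom (V : E -> 'I_n -> \bar R) (i : 'I_n) : set E :=
  [set x | V x i \is a fin_num].

End Fcns.

Section MPC.
Variables (R : realType) (n nx nu : nat).
Variables (A : 'rV[R]_n -> set 'rV[R]_n) (P : 'M[R]_n).
Variable f : 'rV[R]_nx * 'rV[R]_nu -> 'I_n -> 'rV[R]_nx.
Variable l : 'rV[R]_nx * 'rV[R]_nu -> 'I_n -> \bar R.
Variable lN : 'rV[R]_nx -> 'I_n -> \bar R.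

Definition stage_value (V : 'rV[R]_nx -> 'I_n -> \bar R)
    (x : 'rV[R]_nx) (i : 'I_n) (u : 'rV[R]_nu) : \bar R :=
  l (x, u) i + risk A P i (fun j => V (f (x, u) i) j).

Definition bellman (V : 'rV[R]_nx -> 'I_n -> \bar R)
    (x : 'rV[R]_nx) (i : 'I_n) : \bar R :=
  ereal_inf (range (stage_value V x i)).

Definition minimizers (V : 'rV[R]_nx -> 'I_n -> \bar R)
    (x : 'rV[R]_nx) (i : 'I_n) : set 'rV[R]_nu :=
  [set u | stage_value V x i u = bellman V x i].

Definition Vstar (k : nat) : 'rV[R]_nx -> 'I_n -> \bar R := iter k bellman lN.

(* Only meaningful for [0 < k]. *)
Definition Ustar (k : nat) : 'rV[R]_nx -> 'I_n -> set 'rV[R]_nu :=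
  minimizers (Vstar k.-1).

End MPC.

Section ClosedLoop.
Variables (R : realType) (n nx nu : nat).
Variables (A : 'rV[R]_n -> set 'rV[R]_n) (P : 'M[R]_n).
Variable f : 'rV[R]_nx * 'rV[R]_nu -> 'I_n -> 'rV[R]_nx.
Variable Y : 'I_n -> set ('rV[R]_nx * 'rV[R]_nu).
Variable kappa : 'rV[R]_nx -> 'I_n -> 'rV[R]_nu.

Definition closed_loop (x : 'rV[R]_nx) (i : 'I_n) : 'rV[R]_nx :=
  f (x, kappa x i) i.

Definition feasible (i : 'I_n) : set 'rV[R]_nx := [set x | Y i (x, kappa x i)].

(* Uses the first [k] modes of [s]. *)
Definition solution (k : nat) (x0 : 'rV[R]_nx) (s : seq 'I_n) : 'rV[R]_nx :=
  foldl closed_loop x0 (take k s).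

Definition uniformly_invariant (X : 'I_n -> set 'rV[R]_nx) : Prop :=
  (forall i, [/\ X i !=set0, closed (X i) & X i `<=` feasible i]) /\
  (forall i x, X i x -> forall j, j \in cov P i -> X j (closed_loop x i)).

(* The index [k.-1] is 0 for both [k = 0] and [k = 1]: the nested risk measure
   is the identity there. *)
Definition RSES (X : 'I_n -> set 'rV[R]_nx) : Prop :=
  uniformly_invariant X /\
  exists beta lambda : R,
    [/\ (0 <= beta < 1)%R, (0 <= lambda)%R &
      forall (i0 : 'I_n) (x0 : 'rV[R]_nx) (k : nat), X i0 x0 ->
        nested_risk A P k.-1 (fun s => (enorm (solution k x0 s) ^+ 2)%:E) i0
          <= (lambda * beta ^+ k * enorm x0 ^+ 2)%:E].

End ClosedLoop.

(* Main.v *)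
(* Since [bellman lN <= lN], the value iterates decrease, so the optimality
   equation at [kappa x i] gives
   [c |x|^2 + risk V_N (x+) <= c |x|^2 + risk V_(N-1) (x+) <= V_N x].
   On a compact invariant set [V_N] lies between multiples [c |x|^2] and
   [a |x|^2] of the squared norm: near the origin [V_N <= lN <= d |x|^2], away
   from it [V_N] is bounded while [|x|] is bounded below. Hence the risk of
   [V_N] contracts by [1 - c / a] at each step, and the contraction passes
   through the nested risk measure. *)
Require Import Defs.
From mathcomp Require Import all_boot all_order all_algebra.
From mathcomp Require Import all_classical all_reals all_analysis.
From mathcomp Require Import ring.
Import Order.TTheory GRing.Theory Num.Theory.
Import numFieldNormedType.Exports.
Local Open Scope classical_set_scope.
Local Open Scope ring_scope.
Local Open Scope ereal_scope.

(** * Monotonicity, lower bounds and scaling of one-step and nested risk *)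

Section RiskMeasure.
Context {R : realType} {n : nat}.
Context {A : 'rV[R]_n -> set 'rV[R]_n} {P : 'M[R]_n}.
Hypotheses (hA : ambiguity A) (hP : transition_matrix P).

Lemma le_risk i (Z1 Z2 : 'I_n -> \bar R) :
  (forall j, Z1 j <= Z2 j) -> risk A P i Z1 <= risk A P i Z2.
Proof.
move=> Z12; apply: ge_ereal_sup => _ [mu Amu <-].
apply: (@le_trans _ _ (\sum_(j < n) (mu ord0 j)%:E * Z2 j)).
  apply: lee_sum => j _; apply: lee_wpmul2l => //.
  by have [_ _ /(_ _ Amu)[mu0 _] _] := hA _ (hP i); rewrite lee_fin.
by apply: ereal_sup_ubound; exists mu.
Qed.

Lemma expectation_le_risk i (Z : 'I_n -> \bar R) :
  \sum_(j < n) (P i j)%:E * Z j <= risk A P i Z.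
Proof.
have [_ _ _ AP] := hA _ (hP i).
apply: ereal_sup_ubound; exists (row i P) => //.
by apply: eq_bigr => j _; rewrite mxE.
Qed.

Lemma transition_ge0 i j : (0 <= P i j)%R.
Proof. by have [/(_ j)] := hP i; rewrite mxE. Qed.

Lemma risk_ge0 i (Z : 'I_n -> \bar R) :
  (forall j, 0 <= Z j) -> 0 <= risk A P i Z.
Proof.
move=> Z0; apply: le_trans (expectation_le_risk i Z).
by apply: sume_ge0 => j _; rewrite mule_ge0 // lee_fin transition_ge0.
Qed.

Lemma risk_scale_le i (r : R) (Z : 'I_n -> \bar R) : (0 <= r)%R ->
  (forall j, 0 <= Z j) ->
  risk A P i (fun j => r%:E * Z j) <= r%:E * risk A P i Z.
Proof.
move=> r0 Z0; apply: ge_ereal_sup => _ [mu Amu <-].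
have [_ _ /(_ _ Amu)[mu0 _] _] := hA _ (hP i).
under eq_bigr do rewrite muleCA.
rewrite -ge0_sume_distrr; last by move=> j _; rewrite mule_ge0 ?lee_fin.
by apply: lee_wpmul2l; rewrite ?lee_fin //; apply: ereal_sup_ubound; exists mu.
Qed.

(** The nominal row lies in its own ambiguity set and gives weight zero to modes outside [cov P i],
    so its expectation ignores [Z] there and is at least that of the constant [r]. *)
Lemma risk_ge_on_cov i (r : R) (Z : 'I_n -> \bar R) :
  (forall j, j \in cov P i -> r%:E <= Z j) -> r%:E <= risk A P i Z.
Proof.
move=> rZ; apply: le_trans (expectation_le_risk i Z).
have [_ P1] := hP i.
have -> : r%:E = \sum_(j < n) (P i j)%:E * r%:E.
  under eq_bigr do rewrite -EFinM.
  rewrite sumEFin -mulr_suml -[LHS]mul1e -P1 EFinM.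
  by congr (_%:E * _); apply: eq_bigr => j _; rewrite mxE.
apply: lee_sum => j _.
have := transition_ge0 i j; rewrite le_eqVlt => /orP[/eqP <-|Pij].
  by rewrite !mul0e.
by apply: lee_wpmul2l; rewrite ?lee_fin ?(ltW Pij) // rZ // inE.
Qed.

(** Comparing only on paths that start at [i] lets a user of the lemma decide the admissibility of
    the first transition before comparing. *)
Lemma le_nest k (psi1 psi2 : seq 'I_n -> \bar R) i :
  (forall t, psi1 (i :: t) <= psi2 (i :: t)) ->
  nest (risk A P) k psi1 i <= nest (risk A P) k psi2 i.
Proof.
elim: k psi1 psi2 i => [|k IH] psi1 psi2 i psi12 /=; first exact: psi12.
by apply: le_risk => j; apply: IH => t; exact: psi12.
Qed.

Lemma nest0_le0 k i : nest (risk A P) k (fun=> 0) i <= 0.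
Proof.
elim: k i => [|k IH] i //=.
apply: (le_trans (@le_risk i _ (fun=> 0) IH)).
by apply: ge_ereal_sup => _ [mu _ <-]; rewrite big1 // => j _; rewrite mule0.
Qed.

(* A [mu] in [A (row i P)] may charge modes outside [cov P i]; the nested risk
   is [<= 0] there because [on_paths] extends by 0, so [0 <= Z] suffices. *)
Lemma nested_riskS_le k (psi : seq 'I_n -> \bar R) (Z : 'I_n -> \bar R) i :
  (forall j, 0 <= Z j) ->
  (forall j, j \in cov P i ->
    nested_risk A P k (fun s => psi (i :: s)) j <= Z j) ->
  nested_risk A P k.+1 psi i <= risk A P i Z.
Proof.
move=> Z0 psiZ; apply: le_risk => j.
have [ij|ij] := boolP (j \in cov P i).
  apply: le_trans (psiZ j ij); apply: le_nest => t.
  by rewrite /on_paths /admissible /= ij.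
apply: le_trans (Z0 j); apply: le_trans (nest0_le0 k j).
by apply: le_nest => t; rewrite /on_paths /admissible /= (negbTE ij).
Qed.

End RiskMeasure.

(** * A Lyapunov criterion for risk-square exponential stability *)

Section Lyapunov.
Context {R : realType} {n nx nu : nat}.
Context {A : 'rV[R]_n -> set 'rV[R]_n} {P : 'M[R]_n}.
Context {f : 'rV[R]_nx * 'rV[R]_nu -> 'I_n -> 'rV[R]_nx}.
Context {Y : 'I_n -> set ('rV[R]_nx * 'rV[R]_nu)}.
Context {kappa : 'rV[R]_nx -> 'I_n -> 'rV[R]_nu}.
Context {X : 'I_n -> set 'rV[R]_nx} {V : 'rV[R]_nx -> 'I_n -> \bar R}.
Context {a b c : R}.
Hypotheses (hA : ambiguity A) (hP : transition_matrix P).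
Hypothesis hX : uniformly_invariant P f Y kappa X.
Hypotheses (c_gt0 : (0 < c)%R) (a_ge0 : (0 <= a)%R) (b_ge0 : (0 <= b)%R).
(** Required off [X] as well: the risk may charge modes [j] outside [cov P i], for which the
    successor state need not lie in [X j]. *)
Hypothesis V_ge0 : forall x i, 0 <= V x i.
Hypothesis V_lb : forall i x, X i x -> (c * enorm x ^+ 2)%:E <= V x i.
Hypothesis V_ub : forall i x, X i x -> V x i <= (a * enorm x ^+ 2)%:E.
Hypothesis V_decr : forall i x, X i x ->
  risk A P i (V (closed_loop f kappa x i)) <= b%:E * V x i.

(** Induction on the horizon along the tail of the path, which is the closed loop restarted at the
    successor state. Both [k = 0] and [k = 1] are base cases, since [k.-1] is 0 in each. *)
Lemma nested_risk_solution_le k i x : X i x ->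
  nested_risk A P k.-1 (fun s => (enorm (solution f kappa k x s) ^+ 2)%:E) i
    <= (b ^+ k / c)%:E * V x i.
Proof.
have norm_le (y : 'rV[R]_nx) r v : (c * enorm y ^+ 2)%:E <= r%:E * v ->
    (enorm y ^+ 2)%:E <= (r / c)%:E * v.
  move=> yv; rewrite [(r / c)%R]mulrC (EFinM c^-1) -muleA.
  rewrite -[(enorm y ^+ 2)%R](mulKf (lt0r_neq0 c_gt0)).
  by rewrite (EFinM c^-1); apply: lee_wpmul2l; rewrite // lee_fin invr_ge0 ltW.
have [_ X_inv] := hX.
elim: k i x => [|[|k] IH] i x Xx.
- by rewrite /nested_risk /= /on_paths /=; apply: norm_le; rewrite mul1e V_lb.
- rewrite /nested_risk /= /on_paths /=; apply: norm_le; rewrite expr1.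
  (* The successor state does not depend on the next mode [j], and by invariance [V_lb] holds there
     for every [j] in [cov P i]; hence its squared norm, times [c], is below the risk of [V]. *)
  apply: le_trans (V_decr _ _ Xx); apply: (risk_ge_on_cov hA hP) => j ij.
  exact/V_lb/X_inv.
- have r0 : (0 <= b ^+ k.+1 / c)%R by rewrite divr_ge0 ?exprn_ge0 // ltW.
  apply: (@le_trans _ _ (risk A P i
      (fun j => (b ^+ k.+1 / c)%:E * V (closed_loop f kappa x i) j))).
    apply: (nested_riskS_le hA hP) => j; first by rewrite mule_ge0 ?lee_fin.
    by move=> ij; apply: IH; exact: X_inv.
  apply: (le_trans (risk_scale_le hA hP _ _ _ r0 (V_ge0 _))).
  rewrite (exprSr b k.+1) mulrAC (EFinM _ b) -muleA.
  by apply: lee_wpmul2l; rewrite ?lee_fin // V_decr.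
Qed.

Lemma RSES_of_lyapunov : (b < 1)%R -> RSES A P f Y kappa X.
Proof.
(* The overshoot [a / c] combines the upper bound on [V] at the initial state with the lower bound
   at the final one. *)
move=> b1; split=> //; exists b, (a / c)%R; split.
- by rewrite b_ge0.
- by rewrite divr_ge0 // ltW.
move=> i x k Xx; apply: (le_trans (nested_risk_solution_le k _ _ Xx)).
have -> : (a / c * b ^+ k * enorm x ^+ 2 =
    b ^+ k / c * (a * enorm x ^+ 2))%R by ring.
rewrite [leRHS]EFinM; apply: lee_wpmul2l; last exact: V_ub.
by rewrite lee_fin divr_ge0 ?exprn_ge0 // ltW.
Qed.

End Lyapunov.

(** * Monotonicity of value iteration *)

Section ValueIteration.
Context {R : realType} {n nx nu : nat}.
Context {A : 'rV[R]_n -> set 'rV[R]_n} {P : 'M[R]_n}.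
Context {f : 'rV[R]_nx * 'rV[R]_nu -> 'I_n -> 'rV[R]_nx}.
Context {l : 'rV[R]_nx * 'rV[R]_nu -> 'I_n -> \bar R}.
Context {lN : 'rV[R]_nx -> 'I_n -> \bar R}.
Hypotheses (hA : ambiguity A) (hP : transition_matrix P).

Lemma le_bellman (V1 V2 : 'rV[R]_nx -> 'I_n -> \bar R) :
  (forall x i, V1 x i <= V2 x i) ->
  forall x i, bellman A P f l V1 x i <= bellman A P f l V2 x i.
Proof.
move=> V12 x i; apply: le_ereal_inf_tmp => _ [u _ <-].
apply: (@le_trans _ _ (stage_value A P f l V1 x i u)).
  by apply: ereal_inf_lbound; exists u.
by apply: leeD2l; apply: (le_risk hA hP) => j.
Qed.

Lemma Vstar_ge0 : (forall z i, 0 <= l z i) -> (forall x i, 0 <= lN x i) ->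
  forall k x i, 0 <= Vstar A P f l lN k x i.
Proof.
move=> l0 lN0; elim=> [|k IH] x i; first exact: lN0.
apply: le_ereal_inf_tmp => _ [u _ <-]; apply: adde_ge0 => //.
by apply: (risk_ge0 hA hP).
Qed.

(** The hypothesis is the base case, and monotonicity of the Bellman operator propagates it. *)
Lemma VstarS_le : (forall x i, bellman A P f l lN x i <= lN x i) ->
  forall k x i, Vstar A P f l lN k.+1 x i <= Vstar A P f l lN k x i.
Proof. by move=> TlN; elim=> [|k IH] //; exact: le_bellman. Qed.

Lemma Vstar_le_terminal : (forall x i, bellman A P f l lN x i <= lN x i) ->
  forall k x i, Vstar A P f l lN k x i <= lN x i.
Proof.
by move=> TlN; elim=> [|k IH] x i //; apply: le_trans (VstarS_le TlN k x i) _.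
Qed.

End ValueIteration.

(** * Norm comparison and quadratic upper bounds *)

Lemma enorm_ge0 (R : realType) d (x : 'rV[R]_d) : (0 <= enorm x)%R.
Proof. exact: sqrtr_ge0. Qed.

Lemma normr_le_enorm (R : realType) d (x : 'rV[R]_d) : (`|x| <= enorm x)%R.
Proof.
rewrite [leLHS]mx_normrE; apply: bigmax_le => [|[i j] _]; first exact: enorm_ge0.
rewrite ord1 /=.
rewrite -sqrtr_sqr ler_wsqrtr // (bigD1 j) //= lerDl.
by apply: sumr_ge0 => k _; exact: sqr_ge0.
Qed.

Lemma quadratic_bound (R : realType) d (U X : set 'rV[R]_d)
    (v : 'rV[R]_d -> \bar R) (q M : R) :
  U° 0%R -> (forall x, U x -> v x <= (q * enorm x ^+ 2)%:E) ->
  (0 <= M)%R -> (forall x, X x -> v x <= M%:E) ->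
  exists a : R, forall x, X x -> v x <= (a * enorm x ^+ 2)%:E.
Proof.
move=> /nbhs_ballP[r /= r0 rU] vq M0 vM.
(* [q] serves on [U]; off [U] the norm is at least the radius [r], so [M] is at most [M / r ^+ 2]
   times the squared norm. *)
exists (Num.max q (M / r ^+ 2))%R => x Xx.
have [Ux|nUx] := pselect (U x).
  apply: (le_trans (vq _ Ux)).
  by rewrite lee_fin ler_wpM2r ?sqr_ge0 // le_max lexx.
have rx : (r <= enorm x)%R.
  rewrite leNgt; apply/negP => xr; apply/nUx/rU.
  (* The ball inside [U] is a max-norm ball, and it contains the Euclidean one of the same
     radius. *)
  by rewrite -ball_normE /= sub0r normrN (le_lt_trans (normr_le_enorm _ _ x)).
apply: (le_trans (vM _ Xx)); rewrite lee_fin.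
apply: (@le_trans _ _ (M / r ^+ 2 * enorm x ^+ 2)%R).
  rewrite -mulrA ler_peMr // mulrC ler_pdivlMr ?exprn_gt0 // mul1r.
  by rewrite ler_sqr ?nnegrE ?enorm_ge0 // ltW.
by rewrite ler_wpM2r ?sqr_ge0 // le_max lexx orbT.
Qed.

Theorem theorem1 (R : realType) (n nx nu N : nat)
  (P : 'M[R]_n) (A : 'rV[R]_n -> set 'rV[R]_n)
  (f : 'rV[R]_nx * 'rV[R]_nu -> 'I_n -> 'rV[R]_nx)
  (Y : 'I_n -> set ('rV[R]_nx * 'rV[R]_nu))
  (l : 'rV[R]_nx * 'rV[R]_nu -> 'I_n -> \bar R)
  (Xf : 'I_n -> set 'rV[R]_nx)
  (lN : 'rV[R]_nx -> 'I_n -> \bar R)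
  (kappa : 'rV[R]_nx -> 'I_n -> 'rV[R]_nu)
  (hP : transition_matrix P)
  (hA : ambiguity A)
  (hf : forall i, continuous (fun z => f z i))
  (hf0 : forall i, f (0%R, 0%R) i = 0%R)
  (hY : forall i, closed (Y i) /\ Y i (0%R, 0%R))
  (hl : fcns l)
  (hlY : forall i, dom l i = Y i)
  (hlN : fcns lN)
  (hlNX : forall i, dom lN i = Xf i)
  (hN : (1 <= N)%N)
  (h1 : exists2 c : R, (0 < c)%R &
     forall i x u, Y i (x, u) -> (c * enorm x ^+ 2)%:E <= l (x, u) i)
  (h2 : exists2 d : R, (0 < d)%R &
     forall i x, Xf i x -> lN x i <= (d * enorm x ^+ 2)%:E)
  (h3 : forall i, (Xf i)° 0%R)
  (h4 : forall Xbar : 'I_n -> set 'rV[R]_nx,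
     (forall i, compact (Xbar i)) ->
     (forall i, Xbar i `<=` dom (Vstar A P f l lN N) i) ->
     exists2 M : R, (0 <= M)%R &
       forall i x, Xbar i x -> Vstar A P f l lN N x i <= M%:E)
  (h5 : forall x i, bellman A P f l lN x i <= lN x i)
  (hkappa : forall i x, dom (Vstar A P f l lN N) i x ->
     Ustar A P f l lN N x i (kappa x i)) :
  forall X : 'I_n -> set 'rV[R]_nx,
    (forall i, compact (X i)) ->
    uniformly_invariant P f Y kappa X ->
    (forall i, X i `<=` dom (Vstar A P f l lN N) i) ->
    RSES A P f Y kappa X.
Proof.
move=> X cX X_inv XV.
set V := Vstar A P f l lN N in h4 hkappa XV.
have [c c0 l_lb] := h1; have [d d0 lN_ub] := h2; have [M M0 VM] := h4 _ cX XV.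
have V0 : forall x i, 0 <= V x i.
  by apply: (Vstar_ge0 hA hP) => ? ?; [case: hl => + _|case: hlN => + _]; exact.
have /choice[a aP] : forall i, exists a : R,
    forall x, X i x -> V x i <= (a * enorm x ^+ 2)%:E.
  move=> i.
  apply: (quadratic_bound _ _ _ _ _ _ _ (h3 i) _ M0 (VM i)) => x Xfx.
  exact: le_trans (Vstar_le_terminal hA hP h5 N x i) (lN_ub _ _ Xfx).
(* One constant for all modes; the summand [c] makes [b] positive and at least [c], so that
   [1 - c / b] lies in [[0, 1)]. *)
pose b := (c + \sum_i `|a i|)%R.
have cb : (c <= b)%R by rewrite lerDl sumr_ge0.
have b0 : (0 < b)%R := lt_le_trans c0 cb.
have V_ub i x : X i x -> V x i <= (b * enorm x ^+ 2)%:E.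
  move=> /aP /le_trans; apply; rewrite lee_fin ler_wpM2r ?sqr_ge0 //.
  rewrite (le_trans (ler_norm _)) // /b (bigD1 i) //= addrCA lerDl.
  by rewrite addr_ge0 ?sumr_ge0 // ltW.
have V_step i x : X i x -> (c * enorm x ^+ 2)%:E +
    risk A P i (V (closed_loop f kappa x i)) <= V x i.
  move=> Xx; have := hkappa _ _ (XV _ _ Xx).
  rewrite /Ustar /minimizers /=.
  (* The minimizer property equates the stage value built on iterate [N.-1] with one more Bellman
     step, which is iterate [N] because [N] is positive. *)
  rewrite -[bellman _ _ _ _ _ _ _]/(Vstar _ _ _ _ _ _.-1.+1 _ _).
  rewrite prednK // /V => <-; apply: leeD.
    by have [/(_ i)[_ _ XY] _] := X_inv; apply: l_lb; exact: XY.
  apply: (le_risk hA hP) => j.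
  by have := VstarS_le hA hP h5 N.-1 (closed_loop f kappa x i) j; rewrite prednK.
have V_lb i x : X i x -> (c * enorm x ^+ 2)%:E <= V x i.
  move=> /V_step; apply: le_trans.
  by rewrite leeDl // (risk_ge0 hA hP).
(* Here [b] is the upper constant of the criterion and [1 - c / b] its contraction rate. *)
apply: (@RSES_of_lyapunov _ _ _ _ _ _ _ _ _ _ V b (1 - c / b) c) => //.
- exact: ltW.
- by rewrite subr_ge0 ler_pdivrMr // mul1r.
- move=> i x Xx; have := V_step i x Xx; have := V_ub i x Xx.
  (* [V] is finite on [X], so the decrease can be computed in the reals: [v <= b |x|^2] gives
     [v - c |x|^2 <= (1 - c / b) v]. *)
  have /fineK <- := XV _ _ Xx; set v := fine _.
  rewrite lee_fin addeC -leeBrDr // => vb /le_trans; apply.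
  rewrite -EFinB -EFinM lee_fin mulrBl mul1r lerD2l lerN2.
  by rewrite mulrAC -mulrA ler_wpM2l ?(ltW c0) // ler_pdivrMr // mulrC.
- by rewrite ltrBlDr ltrDl divr_gt0.
Qed.
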